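(* Let $A$ be a finite left-symmetric conformal algebra which is free as a $\mathbb{C}[\partial]$-module. Then $r\in A\otimes A$ is a symmetric non-degenerate solution of the conformal $S$-equation in $A$ if and only if the bilinear form defined by $$\beta_\lambda(a,b)=\{T^{-1}(a),b\}_\lambda=\big(T^{-1}(a)\big)_\lambda(b),\qquad a,b\in A,$$ is a symmetric 2-cocycle of $A$, where $T:A^{*c}\to A$ is the $\mathbb{C}[\partial]$-module homomorphism corresponding to $r$ by the $\mathfrak{g}(A)$-module isomorphism $A\otimes A\cong\mathrm{Chom}(A^{*c},A)$. Here $A$ is seen as a module of the sub-adjacent Lie conformal algebra $\mathfrak{g}(A)$ via the left multiplication operators of $A$.
   Context: A left-symmetric conformal algebra is a $\mathbb{C}[\partial]$-module $A$ with a $\mathbb{C}$-bilinear map $A\times A\to A[\lambda]$, $(a,b)\mapsto a_\lambda b$, such that $(\partial a)_\lambda b=-\lambda a_\lambda b$, $a_\lambda(\partial b)=(\partial+\lambda)a_\lambda b$ and $(a_\lambda b)_{\lambda+\mu}c-a_\lambda(b_\mu c)=(b_\mu a)_{\lambda+\mu}c-b_\mu(a_\lambda c)$. It is finite if finitely generated over $\mathbb{C}[\partial]$. The sub-adjacent Lie conformal algebra $\mathfrak{g}(A)$ is the $\mathbb{C}[\partial]$-module $A$ with $\lambda$-bracket $[a_\lambda b]=a_\lambda b-b_{-\lambda-\partial}a$, where substituting $-\lambda-\partial$ for $\lambda$ in $\sum_n\lambda^nc_n$ means $\sum_n(-\lambda-\partial)^nc_n$. Tensor products are over $\mathbb{C}$.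 For $\mathbb{C}[\partial]$-modules $U,V$, $\mathrm{Chom}(U,V)$ is the set of $\mathbb{C}$-linear maps $\varphi_\lambda:U\to V[\lambda]$ with $\varphi_\lambda(\partial u)=(\partial+\lambda)\varphi_\lambda(u)$, a $\mathbb{C}[\partial]$-module by $(\partial\varphi)_\lambda=-\lambda\varphi_\lambda$. The conformal dual $A^{*c}$ is the set of $\mathbb{C}$-linear maps $f_\lambda:A\to\mathbb{C}[\lambda]$ with $f_\lambda(\partial a)=\lambda f_\lambda(a)$, a $\mathbb{C}[\partial]$-module by $(\partial f)_\lambda=-\lambda f_\lambda$. Write $\{f,a\}_\lambda=f_\lambda(a)$. The $\mathfrak{g}(A)$-module structures are: $a$ acts on $b\in A$ by $a_\lambda b$, on $f\in A^{*c}$ by $(a_\lambda f)_\mu b=-f_{\mu-\lambda}(a_\lambda b)$, on $A\otimes A$ by $a_\lambda(b\otimes c)=a_\lambda b\otimes c+b\otimes a_\lambda c$, and on $\varphi\in\mathrm{Chom}(A^{*c},A)$ by $(a_\lambda\varphi)_\mu f=a_\lambda(\varphi_{\mu-\lambda}f)-\varphi_{\mu-\lambda}(a_\lambda f)$. For $r=\sum_ir_i\otimes l_i\in A\otimes A$: $r$ is symmetric if $\sum_ir_i\otimes l_i=\sum_il_i\otimes r_i$. Under the isomorphism $A\otimes A\cong\mathrm{Chom}(A^{*c},A)$, $r$ corresponds to $T^r_\lambda(f)=\sum_if_{-\lambda-\partial}(r_i)\,l_i$, $f\in A^{*c}$ (the polynomial $f_x(r_i)$ is evaluated at $x=-\lambda-\partial$,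 with $\partial$ acting on $l_i$), and $T_0^r=T_\lambda^r|_{\lambda=0}$. The element $r$ is called non-degenerate if $T^r_\lambda=T^r_0$ is a $\mathbb{C}[\partial]$-module isomorphism from $A^{*c}$ to $A$. The homomorphism $T$ in the claim is $T=T_0^r$, i.e. $T(f)=\sum_if_{-\partial}(r_i)\,l_i$. A 2-cocycle of $A$ is a bilinear form $\beta_\lambda:A\otimes A\to\mathbb{C}[\lambda]$ with $\beta_\lambda(\partial a,b)=-\lambda\beta_\lambda(a,b)$, $\beta_\lambda(a,\partial b)=\lambda\beta_\lambda(a,b)$ and $\beta_{\lambda+\mu}(a_\lambda b,c)-\beta_\lambda(a,b_\mu c)=\beta_{\lambda+\mu}(b_\mu a,c)-\beta_\mu(b,a_\lambda c)$ for all $a,b,c\in A$. It is symmetric if $\beta_\lambda(a,b)=\beta_{-\lambda}(b,a)$ for all $a,b\in A$. The conformal $S$-equation for $r=\sum_ir_i\otimes l_i$ in $A$ is $$\sum_{i,j}({l_j}_\mu r_i\otimes r_j\otimes l_i)|_{\mu=1\otimes\partial\otimes1}-\sum_{i,j}(r_j\otimes{l_j}_\mu r_i\otimes l_i)|_{\mu=\partial\otimes1\otimes1}-\sum_{i,j}(r_i\otimes r_j\otimes[{l_i}_\mu l_j])|_{\mu=\partial\otimes1\otimes1}=0\mod(\partial^{\otimes^3})$$ in $A\otimes A\otimes A$, where $\partial^{\otimes^3}=\partial\otimes1\otimes1+1\otimes\partial\otimes1+1\otimes1\otimes\partial$, ''mod $(\partial^{\otimes^3})$'' means modulo $\partial^{\otimes^3}(A\otimes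 A\otimes A)$, and the subscript means each power $\mu^n$ is replaced by the $n$-th power of the indicated operator.
   Formalization: As T depends on r only modulo (∂⊗1+1⊗∂)(A⊗A), the ''if'' part cannot yield r symmetric: the equivalence is proved for symmetric r, and for all r with symmetry modulo that image; non-degenerate means T_0^r is an isomorphism, without T^r_λ=T^r_0. *)

(* Defs.v *)
From HB Require Import structures.
From mathcomp Require Import all_boot all_algebra.
From mathcomp Require Import generic_quotient finmap.
From mathcomp Require Import boolp reals complex.
From mathcomp Require Import monalg.

Set Implicit Arguments.
Unset Strict Implicit.
Unset Printing Implicit Defensive.

Import GRing.Theory.
Local Open Scope ring_scope.
Local Open Scope quotient_scope.

(** * Tensor product of vector spaces

   [tens U V] is the set of finite formal sums of pairs, modulo the congruence
   [tens_rel] generated by the bilinearity relations. *)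

Section Tensor.
Variables (K : nzRingType) (U V : lmodType K).

Inductive tens_rel : seq (U * V) -> seq (U * V) -> Prop :=
| tens_refl s : tens_rel s s
| tens_sym s t : tens_rel s t -> tens_rel t s
| tens_trans s t w : tens_rel s t -> tens_rel t w -> tens_rel s w
| tens_perm s t : perm_eq s t -> tens_rel s t
| tens_cat s s' t t' :
    tens_rel s s' -> tens_rel t t' -> tens_rel (s ++ t) (s' ++ t')
| tens_0 v : tens_rel [:: (0, v)] [::]
| tens_Dl u u' v : tens_rel [:: (u + u', v)] [:: (u, v); (u', v)]
| tens_Dr u v v' : tens_rel [:: (u, v + v')] [:: (u, v); (u, v')]
| tens_Z c u v : tens_rel [:: (c *: u, v)] [:: (u, c *: v)].

Definition tens_relb : rel (seq (U * V)) := fun s t => `[< tens_rel s t >].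

Lemma tens_relb_refl : reflexive tens_relb.
Proof. by move=> s; apply/asboolP; exact: tens_refl. Qed.

Lemma tens_relb_sym : symmetric tens_relb.
Proof.
by move=> s t; apply/idP/idP => /asboolP st; apply/asboolP; exact: tens_sym.
Qed.

Lemma tens_relb_trans : transitive tens_relb.
Proof.
move=> t s w /asboolP st /asboolP tw.
by apply/asboolP; exact: tens_trans tw.
Qed.

Definition tens_equiv : equiv_rel (seq (U * V)) :=
  EquivRel tens_relb tens_relb_refl tens_relb_sym tens_relb_trans.

Definition tens : Type := {eq_quot tens_equiv}.

HB.instance Definition _ := Choice.on tens.

Definition tens_class (s : seq (U * V)) : tens := \pi_({eq_quot tens_equiv}) s.
Definition tens_repr (t : tens) : seq (U * V) :=
  repr (t : {eq_quot tens_equiv}).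

Lemma tens_reprK : cancel tens_repr tens_class.
Proof. exact: reprK. Qed.

Lemma tens_classP s t : tens_class s = tens_class t <-> tens_rel s t.
Proof.
split=> [e|st]; last by apply/eqmodP/asboolP.
by have /eqmodP/asboolP := e.
Qed.

Lemma tens_classK s : tens_rel (tens_repr (tens_class s)) s.
Proof. by apply/tens_classP; rewrite tens_reprK. Qed.

Definition tens_zero : tens := tens_class [::].
Definition tens_add (s t : tens) : tens :=
  tens_class (tens_repr s ++ tens_repr t).
Definition tens_opp (s : tens) : tens :=
  tens_class [seq (- p.1, p.2) | p <- tens_repr s].
Definition tens_scale (c : K) (s : tens) : tens :=
  tens_class [seq (c *: p.1, p.2) | p <- tens_repr s].

Lemma tens_addE s t : tens_add (tens_class s) (tens_class t) = tens_class (s ++ t).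
Proof. by apply/tens_classP; apply: tens_cat; exact: tens_classK. Qed.

Lemma tens_addA : associative tens_add.
Proof.
move=> s t w; rewrite -(tens_reprK s) -(tens_reprK t) -(tens_reprK w).
by rewrite !tens_addE catA.
Qed.

Lemma tens_addC : commutative tens_add.
Proof.
move=> s t; rewrite /tens_add; apply/tens_classP; apply: tens_perm.
by rewrite perm_catC.
Qed.

Lemma tens_add0 : left_id tens_zero tens_add.
Proof. by move=> s; rewrite -(tens_reprK s) tens_addE. Qed.

Lemma tens_addN : left_inverse tens_zero tens_opp tens_add.
Proof.
move=> s; rewrite /tens_opp -{2}(tens_reprK s) tens_addE; apply/tens_classP.
elim: (tens_repr s) => [|[u v] r IH] /=; first exact: tens_refl.
apply: (tens_trans (t := [:: (- u, v); (u, v)] ++ ([seq (- p.1, p.2) | p <- r] ++ r))).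
  apply: tens_perm; rewrite /= perm_cons.
  by rewrite -cat1s perm_catCA.
rewrite -[X in tens_rel _ X]/([::] ++ [::]); apply: tens_cat => //.
apply: tens_trans (tens_0 v); apply: tens_sym.
by rewrite -{1}(addNr u); exact: tens_Dl.
Qed.

HB.instance Definition _ :=
  GRing.isZmodule.Build tens tens_addA tens_addC tens_add0 tens_addN.

Definition tens_pure (u : U) (v : V) : tens := tens_class [:: (u, v)].

Lemma tens_classD s t : tens_class (s ++ t) = tens_class s + tens_class t.
Proof. by rewrite -tens_addE. Qed.

Lemma tens_classE s : tens_class s = \sum_(p <- s) tens_pure p.1 p.2.
Proof.
elim: s => [|[u v] s IH]; first by rewrite big_nil.
by rewrite big_cons -IH -cat1s tens_classD.
Qed.

Lemma tens_sumE (t : tens) : t = \sum_(p <- tens_repr t) tens_pure p.1 p.2.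
Proof. by rewrite -{1}(tens_reprK t) tens_classE. Qed.

Lemma tens_pure0 v : tens_pure 0 v = 0.
Proof. by apply/tens_classP; exact: tens_0. Qed.

Lemma tens_pureDl v : {morph tens_pure^~ v : u u' / u + u'}.
Proof.
by move=> u u'; rewrite -tens_classD; apply/tens_classP; exact: tens_Dl.
Qed.

Lemma tens_pureDr u : {morph tens_pure u : v v' / v + v'}.
Proof.
by move=> v v'; rewrite -tens_classD; apply/tens_classP; exact: tens_Dr.
Qed.

Lemma tens_pureZ c u v : tens_pure (c *: u) v = tens_pure u (c *: v).
Proof. by apply/tens_classP; exact: tens_Z. Qed.

End Tensor.

Section TensorLift.
Variables (K : nzRingType) (U V : lmodType K) (W : zmodType) (B : U -> V -> W).
Hypothesis BDl : forall v, {morph B^~ v : u u' / u + u'}.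
Hypothesis BDr : forall u, {morph B u : v v' / v + v'}.
Hypothesis BZ : forall c u v, B (c *: u) v = B u (c *: v).

Lemma tens_rel_sum s t : tens_rel s t ->
  \sum_(p <- s) B p.1 p.2 = \sum_(p <- t) B p.1 p.2.
Proof.
elim=> {s t} //=.
- by move=> s t w _ -> _ ->.
- by move=> s t st; exact: perm_big.
- by move=> s s' t t' _ e _ e'; rewrite !big_cat /= e e'.
- move=> v; rewrite big_seq1 big_nil /=.
  by apply: (addrI (B 0 v)); rewrite -BDl !addr0.
- by move=> u u' v; rewrite big_seq1 big_cons big_seq1 /= BDl.
- by move=> u v v'; rewrite big_seq1 big_cons big_seq1 /= BDr.
- by move=> c u v; rewrite !big_seq1 /= BZ.
Qed.

Definition tens_lift (t : tens U V) : W := \sum_(p <- tens_repr t) B p.1 p.2.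

Lemma tens_lift_class s : tens_lift (tens_class s) = \sum_(p <- s) B p.1 p.2.
Proof. by apply: tens_rel_sum; exact: tens_classK. Qed.

End TensorLift.

Section TensorLmod.
Variables (K : comNzRingType) (U V : lmodType K).

Lemma tens_scaleE c (s : seq (U * V)) :
  tens_scale c (tens_class s) = \sum_(p <- s) tens_pure (c *: p.1) p.2.
Proof.
rewrite /tens_scale tens_classE big_map /=.
apply: (tens_rel_sum (B := fun u v => tens_pure (c *: u) v)); last first.
- exact: tens_classK.
- by move=> d u v /=; rewrite scalerA mulrC -scalerA tens_pureZ.
- by move=> u v v'; rewrite tens_pureDr.
- by move=> v u u'; rewrite scalerDr tens_pureDl.
Qed.

Lemma tens_scaleA c d (t : tens U V) :
  tens_scale c (tens_scale d t) = tens_scale (c * d) t.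
Proof.
rewrite -(tens_reprK t); set s := tens_repr t.
have -> : tens_scale d (tens_class s) = tens_class [seq (d *: p.1, p.2) | p <- s].
  by rewrite tens_scaleE tens_classE big_map.
rewrite !tens_scaleE big_map; apply: eq_bigr => p _ /=.
by rewrite scalerA.
Qed.

Lemma tens_scale1 : left_id 1 (@tens_scale K U V).
Proof.
move=> t; rewrite -{1}(tens_reprK t) tens_scaleE [RHS]tens_sumE.
by apply: eq_bigr => p _; rewrite scale1r.
Qed.

Lemma tens_scaleDr : right_distributive (@tens_scale K U V) +%R.
Proof.
move=> c s t; rewrite -(tens_reprK s) -(tens_reprK t) -tens_classD.
by rewrite !tens_scaleE big_cat.
Qed.

Lemma tens_scaleDl (t : tens U V) : {morph (@tens_scale K U V)^~ t : c d / c + d}.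
Proof.
move=> c d; rewrite -(tens_reprK t) !tens_scaleE -big_split /=.
by apply: eq_bigr => p _; rewrite scalerDl tens_pureDl.
Qed.

HB.instance Definition _ := GRing.Zmodule_isLmodule.Build K (tens U V)
  tens_scaleA tens_scale1 tens_scaleDr tens_scaleDl.

Lemma tens_pureZl c (u : U) (v : V) : tens_pure (c *: u) v = c *: tens_pure u v.
Proof.
by rewrite [RHS](_ : _ = tens_scale c (tens_pure u v)) // tens_scaleE big_seq1.
Qed.

Lemma tens_pureZr c (u : U) (v : V) : tens_pure u (c *: v) = c *: tens_pure u v.
Proof. by rewrite -tens_pureZ tens_pureZl. Qed.

End TensorLmod.

Section TensorMapLinear.
Variables (K : comNzRingType) (U V U' V' : lmodType K).
Variables (f : {linear U -> U'}) (g : {linear V -> V'}).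

(* f ⊗ g *)
Definition tens_map : tens U V -> tens U' V' := tens_lift (fun u v => tens_pure (f u) (g v)).

Lemma tens_map_class s :
  tens_map (tens_class s) = \sum_(p <- s) tens_pure (f p.1) (g p.2).
Proof.
apply: tens_lift_class => [v u u'|u v v'|c u v].
- by rewrite linearD tens_pureDl.
- by rewrite linearD tens_pureDr.
- by rewrite !linearZ /= tens_pureZ.
Qed.

Lemma tens_map_pure u v : tens_map (tens_pure u v) = tens_pure (f u) (g v).
Proof. by rewrite tens_map_class big_seq1. Qed.

Lemma tens_map_additive : {morph tens_map : s t / s + t}.
Proof.
move=> s t; rewrite -(tens_reprK s) -(tens_reprK t) -tens_classD.
by rewrite !tens_map_class big_cat.
Qed.

Lemma tens_map_scalable : scalable tens_map.
Proof.
move=> c t; rewrite -(tens_reprK t); set s := tens_repr t.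
have -> : c *: tens_class s = tens_class [seq (c *: p.1, p.2) | p <- s].
  by rewrite [LHS]tens_scaleE tens_classE big_map.
rewrite !tens_map_class big_map scaler_sumr; apply: eq_bigr => p _ /=.
by rewrite linearZ /= tens_pureZl.
Qed.

Lemma tens_map_linear : linear tens_map.
Proof. by move=> c s t; rewrite tens_map_additive tens_map_scalable. Qed.

HB.instance Definition _ :=
  GRing.isLinear.Build K (tens U V) (tens U' V') *:%R tens_map tens_map_linear.

End TensorMapLinear.

(** * Polynomials with coefficients in a module

   [{malg V[nat]}] is V[λ] and [{malg V[nat * nat]}] is V[λ,μ]: the key of a
   coefficient is the exponent of the monomial that it multiplies. *)

Section ModulePolynomials.
Implicit Types V W : zmodType.

Definition mpmap (L : choiceType) V W (g : V -> W) (p : {malg V[L]}) :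
    {malg W[L]} :=
  \sum_(k <- msupp p) << g p@_k *g k >>.

Definition mprekey (L L' : choiceType) V (h : L -> L') (p : {malg V[L]}) :
    {malg V[L']} :=
  \sum_(k <- msupp p) << p@_k *g h k >>.

Lemma mpmapE (L : choiceType) V W (g : V -> W) (p : {malg V[L]}) k :
  g 0 = 0 -> (mpmap g p)@_k = g p@_k.
Proof.
move=> g0; rewrite /mpmap raddf_sum /=.
under eq_bigr do rewrite mcoeffU.
case: (boolP (k \in msupp p)) => kp.
  rewrite (bigD1_seq k) ?fset_uniq //= eqxx mulr1n big1 ?addr0 // => l /negPf lk.
  by rewrite lk mulr0n.
rewrite (mcoeff_outdom kp) g0 big_seq big1 // => l lp.
by case: eqP => [lk|_]; rewrite ?mulr0n //; rewrite -lk lp in kp.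
Qed.

Lemma mprekeyE0 (L L' : choiceType) V (h : L -> L') (p : {malg V[L]}) k :
  (forall l, h l != k) -> (mprekey h p)@_k = 0.
Proof.
move=> hk; rewrite /mprekey raddf_sum /= big1 // => l _.
by rewrite mcoeffU (negPf (hk l)) mulr0n.
Qed.

(* λ acting on V[λ] *)
Definition lam V : {malg V[nat]} -> {malg V[nat]} := mprekey S.
Definition mpcst V (v : V) : {malg V[nat]} := << v *g 0%N >>.

(* λ, μ and λ + μ acting on V[λ,μ] *)
Definition lam2 V : {malg V[(nat * nat)%type]} -> {malg V[(nat * nat)%type]} :=
  mprekey (fun k => (k.1.+1, k.2)).
Definition mu2 V : {malg V[(nat * nat)%type]} -> {malg V[(nat * nat)%type]} :=
  mprekey (fun k => (k.1, k.2.+1)).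
Definition lammu2 V (p : {malg V[(nat * nat)%type]}) := lam2 p + mu2 p.
Definition mpcst2 V (v : V) : {malg V[(nat * nat)%type]} := << v *g (0%N, 0%N) >>.

(* sends ∑_n λ^n v_n to ∑_n D^n (g v_n), i.e. substitutes the operator D for λ *)
Definition mpsubst V W (D : W -> W) (g : V -> W) (p : {malg V[nat]}) : W :=
  \sum_(n <- msupp p) iter n D (g p@_n).

End ModulePolynomials.

(** * Left-symmetric conformal algebras

   A K[∂]-module is an [lmodType {poly K}], with ∂ acting as ['X] and the
   scalars of K acting as constant polynomials. *)

Section Conformal.
Variables (K : fieldType) (A : lmodType {poly K}).

Definition dd (a : A) : A := 'X *: a.
Definition cscale (c : K) (a : A) : A := c%:P *: a.

Definition finitely_generated : Prop :=
  exists (n : nat) (e : 'I_n -> A), forall a : A,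
    exists c : 'I_n -> {poly K}, a = \sum_i c i *: e i.

Definition free_module : Prop :=
  exists (I : choiceType) (e : I -> A), forall a : A,
    exists! c : {malg {poly K}[I]}, a = \sum_(i <- msupp c) c@_i *: e i.

Section Product.
Variable m : A -> A -> {malg A[nat]}.

(* (a_x b)_y c and a_x (b_y c) in A[λ,μ], where x and y are among the
   multiplication operators by λ, μ and λ + μ *)
Definition nestl (x y : {malg A[(nat * nat)%type]} -> {malg A[(nat * nat)%type]}) (a b c : A) :=
  mpsubst x (fun u => mpsubst y (@mpcst2 A) (m u c)) (m a b).
Definition nestr (x y : {malg A[(nat * nat)%type]} -> {malg A[(nat * nat)%type]}) (a b c : A) :=
  mpsubst y (fun u => mpsubst x (@mpcst2 A) (m a u)) (m b c).

Record left_symmetric_conformal : Prop := LeftSymmetricConformal {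
  lsc_Dl : forall b, {morph m^~ b : a a' / a + a'};
  lsc_Dr : forall a, {morph m a : b b' / b + b'};
  lsc_Zl : forall (c : K) a b, m (cscale c a) b = mpmap (cscale c) (m a b);
  lsc_Zr : forall (c : K) a b, m a (cscale c b) = mpmap (cscale c) (m a b);
  lsc_ddl : forall a b, m (dd a) b = - lam (m a b);
  lsc_ddr : forall a b, m a (dd b) = mpmap dd (m a b) + lam (m a b);
  lsc_left_symmetry : forall a b c,
    nestl (@lam2 A) (@lammu2 A) a b c - nestr (@lam2 A) (@mu2 A) a b c =
    nestl (@mu2 A) (@lammu2 A) b a c - nestr (@mu2 A) (@lam2 A) b a c
}.

(* -λ-∂ acting on A[λ] *)
Definition opp_lam_dd (p : {malg A[nat]}) : {malg A[nat]} := - lam p - mpmap dd p.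

(* the λ-bracket of the sub-adjacent Lie conformal algebra *)
Definition lbracket (a b : A) : {malg A[nat]} :=
  m a b - mpsubst opp_lam_dd (@mpcst A) (m b a).

End Product.

(** * Conformal dual *)

Record cdual : Type := CDual {
  cdual_fun :> A -> {poly K};
  cdualD : {morph cdual_fun : a b / a + b};
  cdualZ : forall c a, cdual_fun (cscale c a) = c *: cdual_fun a;
  cdual_dd : forall a, cdual_fun (dd a) = 'X * cdual_fun a
}.

Lemma cdual_ext (f g : cdual) : f =1 g -> f = g.
Proof.
case: f => f fD fZ fd; case: g => g gD gZ gd /= /funext fg.
by case: g / fg gD gZ gd => *; f_equal; exact: Prop_irrelevance.
Qed.

HB.instance Definition _ := gen_eqMixin cdual.
HB.instance Definition _ := gen_choiceMixin cdual.

Program Definition cdual_zero : cdual := @CDual (fun=> 0) _ _ _.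
Next Obligation. by move=> a b; rewrite addr0. Qed.
Next Obligation. by rewrite scaler0. Qed.
Next Obligation. by rewrite mulr0. Qed.

Program Definition cdual_opp (f : cdual) : cdual := @CDual (fun a => - f a) _ _ _.
Next Obligation. by move=> a b; rewrite cdualD opprD. Qed.
Next Obligation. by rewrite cdualZ scalerN. Qed.
Next Obligation. by rewrite cdual_dd mulrN. Qed.

Program Definition cdual_add (f g : cdual) : cdual :=
  @CDual (fun a => f a + g a) _ _ _.
Next Obligation. by move=> a b; rewrite !cdualD addrACA. Qed.
Next Obligation. by rewrite !cdualZ scalerDr. Qed.
Next Obligation. by rewrite !cdual_dd mulrDr. Qed.

(* (∂f)_λ = -λ f_λ *)
Program Definition cdual_scale (p : {poly K}) (f : cdual) : cdual :=
  @CDual (fun a => (p \Po - 'X) * f a) _ _ _.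
Next Obligation. by move=> a b; rewrite cdualD mulrDr. Qed.
Next Obligation. by rewrite cdualZ -scalerAr. Qed.
Next Obligation. by rewrite cdual_dd mulrCA. Qed.

Lemma cdual_addA : associative cdual_add.
Proof. by move=> f g h; apply: cdual_ext => a /=; rewrite addrA. Qed.
Lemma cdual_addC : commutative cdual_add.
Proof. by move=> f g; apply: cdual_ext => a /=; rewrite addrC. Qed.
Lemma cdual_add0 : left_id cdual_zero cdual_add.
Proof. by move=> f; apply: cdual_ext => a /=; rewrite add0r. Qed.
Lemma cdual_addN : left_inverse cdual_zero cdual_opp cdual_add.
Proof. by move=> f; apply: cdual_ext => a /=; rewrite addNr. Qed.

HB.instance Definition _ :=
  GRing.isZmodule.Build cdual cdual_addA cdual_addC cdual_add0 cdual_addN.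

Lemma cdual_scaleA p q f : cdual_scale p (cdual_scale q f) = cdual_scale (p * q) f.
Proof. by apply: cdual_ext => a /=; rewrite rmorphM /= mulrA. Qed.
Lemma cdual_scale1 : left_id 1 cdual_scale.
Proof. by move=> f; apply: cdual_ext => a /=; rewrite rmorph1 mul1r. Qed.
Lemma cdual_scaleDr : right_distributive cdual_scale +%R.
Proof. by move=> p f g; apply: cdual_ext => a /=; rewrite mulrDr. Qed.
Lemma cdual_scaleDl f : {morph cdual_scale^~ f : p q / p + q}.
Proof. by move=> p q; apply: cdual_ext => a /=; rewrite rmorphD mulrDl. Qed.

HB.instance Definition _ := GRing.Zmodule_isLmodule.Build {poly K} cdual
  cdual_scaleA cdual_scale1 cdual_scaleDr cdual_scaleDl.

(** * Tensor powers of A over K *)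

(* A as a vector space over K *)
Definition cres : Type := A.
HB.instance Definition _ := GRing.Zmodule.on cres.

Definition cres_scale (c : K) (a : cres) : cres := cscale c a.

Lemma cres_scaleA c d a : cres_scale c (cres_scale d a) = cres_scale (c * d) a.
Proof. by rewrite /cres_scale /cscale scalerA polyCM. Qed.
Lemma cres_scale1 : left_id 1 cres_scale.
Proof. by move=> a; rewrite /cres_scale /cscale scale1r. Qed.
Lemma cres_scaleDr : right_distributive cres_scale +%R.
Proof. by move=> c a b; rewrite /cres_scale /cscale scalerDr. Qed.
Lemma cres_scaleDl a : {morph cres_scale^~ a : c d / c + d}.
Proof. by move=> c d; rewrite /cres_scale /cscale polyCD scalerDl. Qed.

HB.instance Definition _ := GRing.Zmodule_isLmodule.Build K cres
  cres_scaleA cres_scale1 cres_scaleDr cres_scaleDl.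

Definition cdd (a : cres) : cres := dd a.

Lemma cdd_linear : linear cdd.
Proof.
move=> c a b; rewrite /cdd /dd scalerDr; congr (_ + _).
by rewrite [LHS]scalerA mulrC -scalerA.
Qed.

HB.instance Definition _ := GRing.isLinear.Build K cres cres *:%R cdd cdd_linear.

Definition tensor2 := tens cres cres.
Definition tensor3 := tens tensor2 cres.

Definition pure2 (a b : A) : tensor2 := tens_pure (a : cres) (b : cres).
Definition pure3 (a b c : A) : tensor3 := tens_pure (pure2 a b) (c : cres).

Definition dd2 (t : tensor2) : tensor2 :=
  tens_map cdd idfun t + tens_map idfun cdd t.

Definition dd3_1 : tensor3 -> tensor3 := tens_map (tens_map cdd idfun) idfun.
Definition dd3_2 : tensor3 -> tensor3 := tens_map (tens_map idfun cdd) idfun.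
Definition dd3_3 : tensor3 -> tensor3 := tens_map idfun cdd.
Definition dd3 (t : tensor3) : tensor3 := dd3_1 t + dd3_2 t + dd3_3 t.

(** * The conformal S-equation and the map T

   An element r = ∑_i r_i ⊗ l_i of A ⊗ A is given by the families [x] = (r_i)
   and [y] = (l_i). *)

Section Element.
Variables (m : A -> A -> {malg A[nat]}) (n : nat) (x y : 'I_n -> A).

Definition elt2 : tensor2 := \sum_i pure2 (x i) (y i).
Definition elt2_flip : tensor2 := \sum_i pure2 (y i) (x i).

Definition symmetric_tensor : Prop := elt2 = elt2_flip.

(* Symmetry in the quotient of A ⊗ A by the image of ∂ ⊗ 1 + 1 ⊗ ∂. T^r_0, the
   form it induces and the S-equation depend on r only through its class in
   this quotient, so a property of T^r_0 can imply symmetry in this sense only: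
   r = e ⊗ e + ∂²e ⊗ e + ∂e ⊗ ∂e in A = K[∂]e with zero product has the same
   T^r_0 as e ⊗ e, but is not symmetric in A ⊗ A. *)
Definition symmetric_tensor_mod : Prop :=
  exists t : tensor2, elt2 - elt2_flip = dd2 t.

Definition S_lhs : tensor3 :=
  \sum_i \sum_j mpsubst dd3_2 (fun c => pure3 c (x j) (y i)) (m (y j) (x i))
  - \sum_i \sum_j mpsubst dd3_1 (fun c => pure3 (x j) c (y i)) (m (y j) (x i))
  - \sum_i \sum_j
      mpsubst dd3_1 (fun c => pure3 (x i) (x j) c) (lbracket m (y i) (y j)).

Definition conformal_S_equation : Prop := exists t : tensor3, S_lhs = dd3 t.

(* T^r_λ(f) = ∑_i f_{-λ-∂}(r_i) l_i *)
Definition Tlam (f : cdual) : {malg A[nat]} :=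
  \sum_i \sum_(k < size (f (x i)))
    iter k opp_lam_dd (mpcst (cscale (f (x i))`_k (y i))).

(* T^r_0 *)
Definition T0 (f : cdual) : A := (Tlam f)@_0%N.

Lemma T0E f : T0 f = \sum_i (f (x i) \Po - 'X) *: y i.
Proof.
rewrite /T0 /Tlam raddf_sum; apply: eq_bigr => i _.
rewrite raddf_sum /= comp_polyE scaler_suml; apply: eq_bigr => k _.
have iterE l v : (iter l opp_lam_dd (mpcst v))@_0%N = (- 'X) ^+ l *: v :> A.
  elim: l => [|l IH] /=; first by rewrite mcoeffUU scale1r.
  rewrite mcoeffB mcoeffN mprekeyE0 // mpmapE ?/dd ?scaler0 // IH oppr0 add0r.
  by rewrite exprS -scalerA scaleNr.
by rewrite iterE /cscale -mul_polyC mulrC scalerA.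
Qed.

(* The family (T^r_λ)_λ satisfies T^r_λ(∂f) = (λ + ∂) T^r_λ(f), hence can
   only be independent of λ when it vanishes; the isomorphism meant is T^r_0. *)
Definition nondegenerate_tensor : Prop := linear T0 /\ bijective T0.

End Element.

Lemma elt2_surj (r : tensor2) :
  exists (n : nat) (x y : 'I_n -> A), r = elt2 x y.
Proof.
exists (size (tens_repr r)), (fun i => (tnth (in_tuple (tens_repr r)) i).1).
exists (fun i => (tnth (in_tuple (tens_repr r)) i).2).
by rewrite {1}(tens_sumE r) big_tnth.
Qed.

(** * 2-cocycles *)

Section Cocycle.
Variables (m : A -> A -> {malg A[nat]}) (beta : A -> A -> {poly K}).

(* In K[λ,μ] = {poly {poly K}}, λ is ['X%:P] and μ is ['X]; [psubst2 z p] is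
   the value at z of a polynomial in one variable. *)
Definition psubst2 (z : {poly {poly K}}) (p : {poly K}) : {poly {poly K}} :=
  (map_poly (fun c : K => c%:P%:P) p).[z].

Definition cocycle_l (w z : {poly {poly K}}) (a b c : A) : {poly {poly K}} :=
  mpsubst ( *%R w) (fun u => psubst2 z (beta u c)) (m a b).
Definition cocycle_r (w z : {poly {poly K}}) (a b c : A) : {poly {poly K}} :=
  mpsubst ( *%R z) (fun u => psubst2 w (beta a u)) (m b c).

Record two_cocycle : Prop := TwoCocycle {
  cocycle_Dl : forall b, {morph beta^~ b : a a' / a + a'};
  cocycle_Dr : forall a, {morph beta a : b b' / b + b'};
  cocycle_Zl : forall c a b, beta (cscale c a) b = c *: beta a b;
  cocycle_Zr : forall c a b, beta a (cscale c b) = c *: beta a b;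
  cocycle_ddl : forall a b, beta (dd a) b = - 'X * beta a b;
  cocycle_ddr : forall a b, beta a (dd b) = 'X * beta a b;
  cocycle_eq : forall a b c,
    let lambda := 'X%:P in
    let mu := 'X in
    cocycle_l lambda (lambda + mu) a b c - cocycle_r lambda mu a b c =
    cocycle_l mu (lambda + mu) b a c - cocycle_r mu lambda b a c
}.

Definition symmetric_conformal_form : Prop := forall a b, beta a b = beta b a \Po - 'X.

End Cocycle.

(* T = T^r_0 has an inverse, and β_λ(a,b) = (T^{-1} a)_λ(b) is a symmetric
   2-cocycle *)
Definition induced_symmetric_cocycle (m : A -> A -> {malg A[nat]})
    (n : nat) (x y : 'I_n -> A) : Prop :=
  exists Tinv : A -> cdual,
    [/\ cancel (T0 x y) Tinv, cancel Tinv (T0 x y),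
        two_cocycle m (fun a b => Tinv a b)
      & symmetric_conformal_form (fun a b => Tinv a b)].

End Conformal.

(* Main.v *)
Require Import Defs.
From HB Require Import structures.
From mathcomp Require Import all_boot all_algebra.
From mathcomp Require Import finmap boolp reals complex monalg.
From mathcomp Require Import ring.

Set Implicit Arguments.
Unset Strict Implicit.
Unset Printing Implicit Defensive.

Import GRing.Theory.
Local Open Scope ring_scope.

(** Write T for T^r_0, and for f, g, h in the conformal dual put a = T f,
    b = T g, c = T h and nu = - lambda - mu. The form is then
    beta_lambda(a, b) = f_lambda(T g), and everything follows by applying the
    functionals f_lambda, g_mu and h_nu to tensors.

    Symmetry. Evaluating T g gives
    f_lambda(T g) = sum_i g_(-lambda)(r_i) f_lambda(l_i), so that beta is
    symmetric exactly when every f_lambda (x) g_(-lambda) takes the same value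
    on r and on its flip ([symmetric_mod_pairing], [pairing_symmetric_mod]).

    The S-equation. If r is symmetric modulo the image of the total derivation,
    f_lambda (x) g_mu (x) h_nu maps the left-hand side of the S-equation to
      f_lambda(b_mu c) - g_mu(a_lambda c) - h_nu([a_lambda b])
    ([ev3_S]): by sesquilinearity, the sums over r_i (x) l_i reassemble into
    T f, T g and T h. When beta is symmetric,
    beta_(lambda + mu)(u, c) = h_nu(u), so the vanishing of that expression is
    the 2-cocycle identity for a, b, c ([cocycle_eq_defect]); as T is onto, a,
    b and c are arbitrary.

    Separation. It remains to see that a tensor killed by all these functionals
    lies in the image of the total derivation ([dd2_separated],
    [dd3_separated]). A finite free module has a finite dual basis (e_i, d_i)
    with a = sum_i d_i(a) e_i. Modulo the total derivation a derivation on the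
    last factor moves to the other ones, so that a tensor is congruent to a
    combination of the tensors of the e_i whose coefficients are polynomials in
    the remaining derivations; these polynomials are the values at the tensor
    of the products of the d_i. *)

(** * Additive maps *)

Lemma morph_add0 (U W : zmodType) (g : U -> W) : {morph g : u v / u + v} -> g 0 = 0.
Proof. by move=> gD; apply: (addrI (g 0)); rewrite -gD !addr0. Qed.

Lemma morph_addN (U W : zmodType) (g : U -> W) :
  {morph g : u v / u + v} -> {morph g : u / - u}.
Proof.
move=> gD u; apply: (addrI (g u)); rewrite -gD !subrr; exact: morph_add0.
Qed.

Lemma morph_sum (U W : zmodType) (g : U -> W) : {morph g : u v / u + v} ->
  forall (I : Type) (r : seq I) (P : pred I) (F : I -> U),
  g (\sum_(i <- r | P i) F i) = \sum_(i <- r | P i) g (F i).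
Proof. by move=> gD *; apply: big_morph => //; exact: morph_add0. Qed.

(** * Substitution of an element of a ring for lambda *)

Section Evaluation.
Variables (V : zmodType) (B : comNzRingType).

Lemma mpsubst_mulE (w : B) (g : V -> B) (d : {fset nat}) p :
  g 0 = 0 -> (msupp p `<=` d)%fset ->
  mpsubst ( *%R w) g p = \sum_(k <- d) w ^+ k * g p@_k.
Proof.
move=> g0 pd; rewrite /mpsubst (big_fset_incl _ pd) /=.
  by apply: eq_bigr => k _; rewrite iter_mulr.
by move=> k _ kp; rewrite mcoeff_outdom // g0 iter_mulr mulr0.
Qed.

Variables (w : B) (g : V -> B).
Hypothesis gD : {morph g : u v / u + v}.
Let g0 := morph_add0 gD.

Lemma mpsubst_mulD : {morph mpsubst ( *%R w) g : p q / p + q}.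
Proof.
move=> p q; pose d := (msupp p `|` msupp q)%fset.
rewrite !(@mpsubst_mulE _ _ d) //; last exact: msuppD_le.
- by rewrite -big_split /=; apply: eq_bigr => k _; rewrite mcoeffD gD mulrDr.
- exact: fsubsetUr.
- exact: fsubsetUl.
Qed.

Lemma mpsubst_mulU k v : mpsubst ( *%R w) g << v *g k >> = w ^+ k * g v.
Proof.
rewrite (@mpsubst_mulE _ _ [fset k]%fset) //; last exact: msuppU_le.
by rewrite big_seq_fset1 mcoeffUU.
Qed.

Lemma mpsubst_lam p : mpsubst ( *%R w) g (lam p) = w * mpsubst ( *%R w) g p.
Proof.
rewrite /lam /mprekey (morph_sum mpsubst_mulD) /mpsubst mulr_sumr.
by apply: eq_bigr => k _; rewrite -/(mpsubst _ _ _) mpsubst_mulU iter_mulr exprS mulrA.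
Qed.

Lemma mpsubst_mpmap (h : V -> V) z p : (forall v, g (h v) = z * g v) ->
  mpsubst ( *%R w) g (mpmap h p) = z * mpsubst ( *%R w) g p.
Proof.
move=> gh; rewrite /mpmap (morph_sum mpsubst_mulD) /mpsubst mulr_sumr.
apply: eq_bigr => k _; rewrite -/(mpsubst _ _ _) mpsubst_mulU iter_mulr gh.
by rewrite mulrCA.
Qed.

End Evaluation.

(** A map that intertwines the operators substituted for lambda commutes with
    the substitution; this evaluates the subscripts of the S-equation and the
    substitution of - lambda - d in the bracket. *)
Lemma mpsubst_morph (V W W' : zmodType) (G : W -> W') (D : W -> W) (D' : W' -> W')
    (g : V -> W) p :
  {morph G : u v / u + v} -> (forall u, G (D u) = D' (G u)) ->
  G (mpsubst D g p) = mpsubst D' (G \o g) p.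
Proof.
move=> GD GDD; rewrite /mpsubst (morph_sum GD); apply: eq_bigr => k _.
by elim: k (p@_k) => //= k IH v; rewrite GDD IH.
Qed.

(** * Specialization of one-variable polynomials in K[lambda, mu] *)

Section Substitution.
Variable K : fieldType.
Local Notation B := {poly {poly K}}.
Implicit Types (z : B) (p q : {poly K}).

Lemma psubst2D z : {morph psubst2 z : p q / p + q}.
Proof.
move=> p q; rewrite /psubst2 -hornerD; congr horner.
exact: (rmorphD (map_poly (polyC \o polyC))).
Qed.

Lemma psubst2M z : {morph psubst2 z : p q / p * q}.
Proof.
move=> p q; rewrite /psubst2 -hornerM; congr horner.
exact: (rmorphM (map_poly (polyC \o polyC))).
Qed.

Lemma psubst2C z (c : K) : psubst2 z c%:P = c%:P%:P.
Proof.
have -> : psubst2 z c%:P = (map_poly (polyC \o polyC) c%:P).[z] by [].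
by rewrite map_polyC hornerC.
Qed.

Lemma psubst2X z : psubst2 z 'X = z.
Proof.
have -> : psubst2 z 'X = (map_poly (polyC \o polyC) 'X).[z] by [].
by rewrite map_polyX hornerX.
Qed.

Lemma psubst2_comp z p q : psubst2 z (p \Po q) = psubst2 (psubst2 z q) p.
Proof.
elim/poly_ind: p => [|p c IH]; first by rewrite comp_poly0 -[0]polyC0 !psubst2C.
rewrite comp_poly_MXaddC psubst2D psubst2M IH psubst2C.
by rewrite psubst2D psubst2M psubst2X psubst2C.
Qed.

Lemma psubst2N z p : psubst2 z (p \Po - 'X) = psubst2 (- z) p.
Proof. by rewrite psubst2_comp (morph_addN (@psubst2D z)) psubst2X. Qed.

Lemma psubst2_polyC p : psubst2 'X%:P p = p%:P.
Proof.
elim/poly_ind: p => [|p c IH]; first by rewrite -[0]polyC0 !psubst2C.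
by rewrite psubst2D psubst2M psubst2X psubst2C IH polyCD polyCM.
Qed.

Lemma psubst2_mu q : psubst2 'X q = map_poly polyC q.
Proof.
elim/poly_ind: q => [|q c IH]; first by rewrite -[0]polyC0 psubst2C map_polyC.
by rewrite psubst2D psubst2M psubst2X psubst2C IH rmorphD rmorphM /= map_polyX map_polyC.
Qed.

End Substitution.

(** * Maps to K[lambda, mu] along which the derivation becomes a scalar *)

Section LinearAt.
Variables (K : fieldType) (A : lmodType {poly K}).
Local Notation B := {poly {poly K}}.
Implicit Types (z : B) (phi : A -> B).

(** Both f_z and the maps u |-> f_z(a_w u), u |-> f_z(u_w a) are of this kind,
    for different values of z; this is the common form of sesquilinearity. *)
Record linear_at z phi : Prop := LinearAt {
  linear_atD : {morph phi : a b / a + b};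
  linear_atZ : forall p a, phi (p *: a) = psubst2 z p * phi a
}.

(** K[d] is generated by the constants and d, which is how sesquilinearity is
    given for products and dual elements. *)
Lemma linear_at_generators z phi : {morph phi : a b / a + b} ->
  (forall c a, phi (cscale c a) = c%:P%:P * phi a) ->
  (forall a, phi (dd a) = z * phi a) -> linear_at z phi.
Proof.
move=> phiD phiZ phid; split=> // p; elim/poly_ind: p => [|p c IH] a.
  by rewrite scale0r morph_add0 // -[0]polyC0 psubst2C mul0r.
rewrite scalerDl phiD -scalerA IH [phi ('X *: a)]phid [phi (c%:P *: a)]phiZ.
by rewrite psubst2D psubst2M psubst2X psubst2C mulrDl mulrA.
Qed.

Lemma cdual_linear_at z (f : cdual A) : linear_at z (fun a => psubst2 z (f a)).
Proof.
apply: linear_at_generators => [a b|c a|a].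
- by rewrite cdualD psubst2D.
- by rewrite cdualZ -mul_polyC psubst2M psubst2C.
- by rewrite cdual_dd psubst2M psubst2X.
Qed.

End LinearAt.

(** * Evaluation of tensors *)

Section TensorEvaluation.
Variables (K : fieldType) (A : lmodType {poly K}).
Local Notation B := {poly {poly K}}.

Lemma tens_induction (U V : lmodType K) (P : tens U V -> Prop) :
  P 0 -> (forall s t, P s -> P t -> P (s + t)) ->
  (forall u v, P (tens_pure u v)) -> forall t, P t.
Proof.
move=> P0 PD Pu t; rewrite (tens_sumE t).
by elim/big_ind: _ => // p _; exact: Pu.
Qed.

Lemma tens_lift_add (U V : lmodType K) (W : zmodType) (b : U -> V -> W) :
  (forall v, {morph b^~ v : u u' / u + u'}) ->
  (forall u, {morph b u : v v' / v + v'}) ->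
  (forall c u v, b (c *: u) v = b u (c *: v)) ->
  {morph tens_lift b : s t / s + t}.
Proof.
move=> bDl bDr bZ s t; rewrite -(tens_reprK s) -(tens_reprK t) -tens_classD.
by rewrite !tens_lift_class // big_cat.
Qed.

Lemma tens_lift_pure (U V : lmodType K) (W : zmodType) (b : U -> V -> W) u v :
  (forall v, {morph b^~ v : u u' / u + u'}) ->
  (forall u, {morph b u : v v' / v + v'}) ->
  (forall c u v, b (c *: u) v = b u (c *: v)) ->
  tens_lift b (tens_pure u v) = b u v.
Proof. by move=> bDl bDr bZ; rewrite tens_lift_class // big_seq1. Qed.

Section Pair.
Variables (z1 z2 : B) (phi psi : A -> B).
Hypothesis (phiL : linear_at z1 phi) (psiL : linear_at z2 psi).

Definition ev2 : tensor2 A -> B :=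
  tens_lift (fun a b : cres A => phi a * psi b).

Let bDl (b : cres A) : {morph (fun a : cres A => phi a * psi b) : a a' / a + a'}.
Proof. by move=> a a'; rewrite (linear_atD phiL) mulrDl. Qed.
Let bDr (a : cres A) : {morph (fun b : cres A => phi a * psi b) : b b' / b + b'}.
Proof. by move=> b b'; rewrite (linear_atD psiL) mulrDr. Qed.
Let bZ c (a b : cres A) : phi (c *: a) * psi b = phi a * psi (c *: b).
Proof.
rewrite [phi _](linear_atZ phiL) [psi (_ *: _)](linear_atZ psiL) !psubst2C.
by rewrite mulrCA mulrA.
Qed.

Lemma ev2_add : {morph ev2 : s t / s + t}.
Proof. exact: tens_lift_add bDl bDr bZ. Qed.

Lemma ev2_pure a b : ev2 (pure2 a b) = phi a * psi b.
Proof. exact: (tens_lift_pure (a : cres A) (b : cres A) bDl bDr bZ). Qed.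

Lemma ev2_scale c t : ev2 (c *: t) = c%:P%:P * ev2 t.
Proof.
elim/tens_induction: t => [|s t es et|u v].
- by rewrite scaler0 (morph_add0 ev2_add) mulr0.
- by rewrite scalerDr !ev2_add es et mulrDr.
rewrite -tens_pureZl [LHS]ev2_pure [ev2 _]ev2_pure.
by rewrite [phi _](linear_atZ phiL) psubst2C mulrA.
Qed.

Lemma ev2_dd_l t : ev2 (tens_map (@cdd K A) idfun t) = z1 * ev2 t.
Proof.
elim/tens_induction: t => [|s t es et|u v].
- by rewrite linear0 (morph_add0 ev2_add) mulr0.
- by rewrite linearD !ev2_add es et mulrDr.
rewrite tens_map_pure [LHS]ev2_pure [ev2 _]ev2_pure.
by rewrite [phi _](linear_atZ phiL) psubst2X mulrA.
Qed.

Lemma ev2_dd_r t : ev2 (tens_map idfun (@cdd K A) t) = z2 * ev2 t.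
Proof.
elim/tens_induction: t => [|s t es et|u v].
- by rewrite linear0 (morph_add0 ev2_add) mulr0.
- by rewrite linearD !ev2_add es et mulrDr.
rewrite tens_map_pure [LHS]ev2_pure [ev2 _]ev2_pure.
by rewrite [psi _](linear_atZ psiL) psubst2X mulrCA.
Qed.

(** The factor vanishes at z2 = - z1: this is why f_lambda is paired with
    g_(-lambda). *)
Lemma ev2_dd2 t : ev2 (dd2 t) = (z1 + z2) * ev2 t.
Proof. by rewrite /dd2 ev2_add ev2_dd_l ev2_dd_r mulrDl. Qed.

Section Triple.
Variables (z3 : B) (chi : A -> B).
Hypothesis chiL : linear_at z3 chi.

Definition ev3 : tensor3 A -> B :=
  tens_lift (fun (t : tensor2 A) (c : cres A) => ev2 t * chi c).

Let tDl (c : cres A) : {morph (fun t => ev2 t * chi c) : s t / s + t}.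
Proof. by move=> s t; rewrite ev2_add mulrDl. Qed.
Let tDr t : {morph (fun c : cres A => ev2 t * chi c) : c c' / c + c'}.
Proof. by move=> c c'; rewrite (linear_atD chiL) mulrDr. Qed.
Let tZ k t (c : cres A) : ev2 (k *: t) * chi c = ev2 t * chi (k *: c).
Proof.
by rewrite ev2_scale [chi (_ *: _)](linear_atZ chiL) !psubst2C mulrCA mulrA.
Qed.

Lemma ev3_add : {morph ev3 : s t / s + t}.
Proof. exact: tens_lift_add tDl tDr tZ. Qed.

Lemma ev3_pure_tens t (c : cres A) : ev3 (tens_pure t c) = ev2 t * chi c.
Proof. exact: (tens_lift_pure t c tDl tDr tZ). Qed.

Lemma ev3_pure a b c : ev3 (pure3 a b c) = phi a * psi b * chi c.
Proof. by rewrite [LHS]ev3_pure_tens ev2_pure. Qed.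

Lemma ev3_dd3_1 t : ev3 (dd3_1 t) = z1 * ev3 t.
Proof.
elim/tens_induction: t => [|s t es et|u v].
- by rewrite /dd3_1 linear0 (morph_add0 ev3_add) mulr0.
- by rewrite /dd3_1 linearD !ev3_add es et mulrDr.
by rewrite /dd3_1 tens_map_pure !ev3_pure_tens ev2_dd_l mulrA.
Qed.

Lemma ev3_dd3_2 t : ev3 (dd3_2 t) = z2 * ev3 t.
Proof.
elim/tens_induction: t => [|s t es et|u v].
- by rewrite /dd3_2 linear0 (morph_add0 ev3_add) mulr0.
- by rewrite /dd3_2 linearD !ev3_add es et mulrDr.
by rewrite /dd3_2 tens_map_pure !ev3_pure_tens ev2_dd_r mulrA.
Qed.

Lemma ev3_dd3_3 t : ev3 (dd3_3 t) = z3 * ev3 t.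
Proof.
elim/tens_induction: t => [|s t es et|u v].
- by rewrite /dd3_3 linear0 (morph_add0 ev3_add) mulr0.
- by rewrite /dd3_3 linearD !ev3_add es et mulrDr.
rewrite /dd3_3 tens_map_pure !ev3_pure_tens.
by rewrite [chi _](linear_atZ chiL) psubst2X mulrCA.
Qed.

(** The factor vanishes at z3 = - z1 - z2: this is why the third functional is
    taken at - lambda - mu. *)
Lemma ev3_dd3 t : ev3 (dd3 t) = (z1 + z2 + z3) * ev3 t.
Proof. by rewrite /dd3 !ev3_add ev3_dd3_1 ev3_dd3_2 ev3_dd3_3 !mulrDl. Qed.

End Triple.
End Pair.
End TensorEvaluation.

(** * Congruence modulo the image of an additive map *)

Section Congruence.
Variables (U : zmodType) (D : U -> U).
Hypothesis DD : {morph D : u v / u + v}.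

Definition congr_im (s t : U) : Prop := exists w, s - t = D w.

Lemma congr_im_refl t : congr_im t t.
Proof. by exists 0; rewrite subrr morph_add0. Qed.

Lemma congr_imN s t : congr_im s t -> congr_im (- s) (- t).
Proof. by case=> w e; exists (- w); rewrite (morph_addN DD) -e opprD. Qed.

Lemma congr_imD s t s' t' :
  congr_im s t -> congr_im s' t' -> congr_im (s + s') (t + t').
Proof. by case=> w e [w' e']; exists (w + w'); rewrite DD -e -e' opprD addrACA. Qed.

Lemma congr_im_trans t s u : congr_im s t -> congr_im t u -> congr_im s u.
Proof. by case=> w e [w' e']; exists (w + w'); rewrite DD -e -e' addrA subrK. Qed.

Lemma congr_im_sum (I : finType) (F G : I -> U) :
  (forall i, congr_im (F i) (G i)) -> congr_im (\sum_i F i) (\sum_i G i).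
Proof.
move=> FG; elim/big_rec2: _ => [|i s t _ st]; first exact: congr_im_refl.
exact: congr_imD.
Qed.

End Congruence.

(** * Pure tensors and the total derivation *)

Section PureTensors.
Variables (K : fieldType) (A : lmodType {poly K}).
Implicit Types (a b c : A).

Lemma pure2Dl b : {morph (fun a => pure2 a b) : a a' / a + a'}.
Proof. by move=> a a'; exact: (@tens_pureDl _ (cres A) (cres A)). Qed.
Lemma pure2Dr a : {morph pure2 a : b b' / b + b'}.
Proof. by move=> b b'; exact: (@tens_pureDr _ (cres A) (cres A)). Qed.
Lemma pure2Z (k : K) a b : pure2 a (k%:P *: b) = pure2 (k%:P *: a) b.
Proof. exact/esym/(@tens_pureZ _ (cres A) (cres A)). Qed.

Lemma pure3D1 b c : {morph (fun a => pure3 a b c) : a a' / a + a'}.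
Proof. by move=> a a'; rewrite /pure3 pure2Dl tens_pureDl. Qed.
Lemma pure3D2 a c : {morph (fun b => pure3 a b c) : b b' / b + b'}.
Proof. by move=> b b'; rewrite /pure3 pure2Dr tens_pureDl. Qed.
Lemma pure3D3 a b : {morph pure3 a b : c c' / c + c'}.
Proof. by move=> c c'; exact: (@tens_pureDr _ (tensor2 A) (cres A)). Qed.
Lemma pure3Z2 (k : K) a b c : pure3 a (k%:P *: b) c = pure3 (k%:P *: a) b c.
Proof. by rewrite /pure3 pure2Z. Qed.
Lemma pure3Z3 (k : K) a b c : pure3 a b (k%:P *: c) = pure3 (k%:P *: a) b c.
Proof.
have -> : pure3 (k%:P *: a) b c = tens_pure (k *: pure2 a b) (c : cres A).
  by congr tens_pure; exact: (@tens_pureZl _ (cres A) (cres A)).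
exact/esym/(@tens_pureZ _ (tensor2 A) (cres A)).
Qed.

Lemma dd2_add : {morph @dd2 K A : s t / s + t}.
Proof. by move=> s t; rewrite /dd2 !linearD addrACA. Qed.

Lemma dd3_1_add : {morph @dd3_1 K A : s t / s + t}.
Proof. by move=> s t; rewrite /dd3_1 linearD. Qed.
Lemma dd3_2_add : {morph @dd3_2 K A : s t / s + t}.
Proof. by move=> s t; rewrite /dd3_2 linearD. Qed.
Lemma dd3_3_add : {morph @dd3_3 K A : s t / s + t}.
Proof. by move=> s t; rewrite /dd3_3 linearD. Qed.

Lemma dd3_add : {morph @dd3 K A : s t / s + t}.
Proof.
by move=> s t; rewrite /dd3 dd3_1_add dd3_2_add dd3_3_add (addrACA (dd3_1 s)) [LHS]addrACA.
Qed.

Lemma dd2_pure a b : dd2 (pure2 a b) = pure2 ('X *: a) b + pure2 a ('X *: b).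
Proof. by rewrite /dd2 /pure2 !tens_map_pure. Qed.

Lemma dd3_pure a b c :
  dd3 (pure3 a b c) = pure3 ('X *: a) b c + pure3 a ('X *: b) c + pure3 a b ('X *: c).
Proof.
rewrite /dd3 /dd3_1 /dd3_2 /dd3_3 /pure3 !tens_map_pure.
by congr (tens_pure _ _ + tens_pure _ _ + _); exact: tens_map_pure.
Qed.

End PureTensors.

(** * Dual basis of a finite free module *)

Section DualBasis.
Variables (K : fieldType) (A : lmodType {poly K}).

(** The index set of the given basis may be infinite a priori; only the basis
    elements in the supports of finitely many generators ever occur, and the
    coordinates on those are the dual basis. *)
Lemma finite_free_dual_basis : finitely_generated A -> free_module A ->
  exists (N : nat) (e : 'I_N -> A) (d : 'I_N -> cdual A),
    forall a, a = \sum_i d i a *: e i.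
Proof.
case=> n [gen gen_span] [I [e e_basis]].
pose comb (c : {malg {poly K}[I]}) := \sum_(i <- msupp c) c@_i *: e i.
have combE (d : {fset I}) c : (msupp c `<=` d)%fset ->
    comb c = \sum_(i <- d) c@_i *: e i.
  move=> cd; rewrite /comb (big_fset_incl _ cd) // => i _ ic.
  by rewrite mcoeff_outdom // scale0r.
have combD : {morph comb : c c' / c + c'}.
  move=> c c'; pose d := (msupp c `|` msupp c')%fset.
  rewrite !(combE d) ?fsubsetUl ?fsubsetUr ?msuppD_le // -big_split /=.
  by apply: eq_bigr => i _; rewrite mcoeffD scalerDl.
have combZ p c : comb (p *: c) = p *: comb c.
  rewrite (combE _ (p *: c) (msuppZ_le p c)) /comb scaler_sumr.
  by apply: eq_bigr => i _; rewrite mcoeffZ scalerA.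
pose coord a := projT1 (cid (e_basis a)).
have coordP a : a = comb (coord a).
  by rewrite /coord; case: (cid _) => c [].
have coord_uniq a c : a = comb c -> coord a = c.
  by rewrite /coord; case: (cid _) => c' /= [_ u] /u.
have coordD : {morph coord : a b / a + b}.
  by move=> a b; apply: coord_uniq; rewrite combD -!coordP.
have coordZ p a : coord (p *: a) = p *: coord a.
  by apply: coord_uniq; rewrite combZ -coordP.
pose s : {fset I} := (\bigcup_(k <- enum 'I_n) msupp (coord (gen k)))%fset.
have supp_coord a : (msupp (coord a) `<=` s)%fset.
  have [q ->] := gen_span a; apply/fsubsetP => i; rewrite -mcoeff_neq0.
  apply: contraR => i_s; rewrite (morph_sum coordD) raddf_sum big1 // => k _ /=.
  rewrite coordZ mcoeffZ mcoeff_outdom ?mulr0 //.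
  apply: contra i_s => ik; apply/bigfcupP; exists k => //.
  by rewrite mem_enum.
pose N := size (enum_fset s); pose t := in_tuple (enum_fset s).
have dD (i : 'I_N) : {morph (fun a => (coord a)@_(tnth t i)) : a b / a + b}.
  by move=> a b; rewrite coordD mcoeffD.
have dZ (i : 'I_N) k a :
    (coord (cscale k a))@_(tnth t i) = k *: (coord a)@_(tnth t i).
  by rewrite coordZ mcoeffZ mul_polyC.
have dd_ (i : 'I_N) a :
    (coord (dd a))@_(tnth t i) = 'X * (coord a)@_(tnth t i).
  by rewrite coordZ mcoeffZ.
exists N, (fun i => e (tnth t i)), (fun i => CDual (dD i) (dZ i) (dd_ i)) => a.
rewrite {1}[a]coordP (combE s) //=.
by rewrite (big_tnth _ _ (enum_fset s)).
Qed.

End DualBasis.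

(** * Functionals separate tensors modulo the total derivation *)

Section Separation.
Variables (K : fieldType) (A : lmodType {poly K}).
Local Notation B := {poly {poly K}}.
Variables (N : nat) (e : 'I_N -> A) (d : 'I_N -> cdual A).
Hypothesis dec : forall a, a = \sum_i d i a *: e i.
Local Notation lambda := ('X%:P : B).
Local Notation mu := ('X : B).

(** Modulo the total derivation, d on the second factor is - d on the first. *)
Lemma pure2_normal p q (a b : A) :
  congr_im (@dd2 K A) (pure2 (p *: a) (q *: b)) (pure2 ((p * (q \Po - 'X)) *: a) b).
Proof.
elim/poly_ind: q p b => [|q c IH] p b.
  rewrite comp_poly0 scale0r mulr0 scale0r.
  rewrite (morph_add0 (pure2Dr _)) (morph_add0 (pure2Dl _)).
  exact: congr_im_refl (@dd2_add K A) _.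
rewrite scalerDl pure2Dr comp_poly_MXaddC mulrDr scalerDl pure2Dl.
apply: congr_imD; first exact: dd2_add; last first.
  by rewrite pure2Z scalerA mulrC; exact: congr_im_refl (@dd2_add K A) _.
rewrite -(scalerA q); apply: (congr_im_trans (@dd2_add K A) (IH _ _)).
exists (pure2 ((p * (q \Po - 'X)) *: a) b).
rewrite dd2_pure addrC; congr (_ + _).
rewrite mulrN mulrN scaleNr (morph_addN (pure2Dl _)) opprK scalerA.
by rewrite mulrA mulrC.
Qed.

Lemma dd2_separated (t : tensor2 A) :
  (forall f g : cdual A,
    ev2 (fun a => psubst2 lambda (f a)) (fun b => psubst2 (- lambda) (g b)) t = 0) ->
  exists s, t = dd2 s.
Proof.
pose ev i j := ev2 (fun a => psubst2 lambda (d i a)) (fun b => psubst2 (- lambda) (d j b)).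
have evD i j : {morph ev i j : s t / s + t}.
  by apply: ev2_add; exact: cdual_linear_at.
pose nf s := \sum_i \sum_j pure2 ((ev i j s)`_0 *: e i) (e j).
have nfP s : congr_im (@dd2 K A) s (nf s).
  elim/tens_induction: s => [|s s' es es'|a b].
  - rewrite [nf 0]big1; first exact: congr_im_refl (@dd2_add K A) _.
    move=> i _; rewrite big1 // => j _.
    by rewrite (morph_add0 (evD i j)) coef0 scale0r (morph_add0 (pure2Dl _)).
  - have -> : nf (s + s') = nf s + nf s'.
      rewrite /nf -big_split; apply: eq_bigr => i _.
      rewrite -big_split; apply: eq_bigr => j _ /=.
      by rewrite evD coefD scalerDl pure2Dl.
    exact: congr_imD (@dd2_add K A) _ _ _ _ es es'.
  rewrite -/(pure2 a b) {1}[a]dec {1}[b]dec (morph_sum (pure2Dl _)).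
  apply: congr_im_sum => [|i]; first exact: dd2_add.
  rewrite (morph_sum (pure2Dr _)).
  apply: congr_im_sum => [|j]; first exact: dd2_add.
  (* This value is a constant polynomial in mu, so its coefficient of index 0
     is the whole of it. *)
  have -> : (ev i j (pure2 a b))`_0 = d i a * (d j b \Po - 'X).
    rewrite /ev (ev2_pure (cdual_linear_at _ _) (cdual_linear_at _ _)).
    by rewrite -psubst2N !psubst2_polyC -polyCM coefC.
  exact: pure2_normal.
move=> t0; have [s] := nfP t; rewrite [nf t]big1 ?subr0; first by exists s.
move=> i _; rewrite big1 // => j _; rewrite /ev t0.
by rewrite coef0 scale0r (morph_add0 (pure2Dl _)).
Qed.

(** The operator P(d (x) 1 (x) 1, 1 (x) d (x) 1) applied to a (x) b (x) c, where
    P`_l is the coefficient of mu^l in P. *)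
Definition normal3 (a b c : A) (P : B) : tensor3 A :=
  \sum_(l < size P) pure3 (P`_l *: a) ('X^l *: b) c.

Lemma normal3E k a b c (P : B) : (size P <= k)%N ->
  normal3 a b c P = \sum_(l < k) pure3 (P`_l *: a) ('X^l *: b) c.
Proof.
move=> Pk; rewrite /normal3 (big_ord_widen _ (fun l => pure3 (P`_l *: a) ('X^l *: b) c) Pk).
rewrite big_mkcond; apply: eq_bigr => l _; case: ifPn => //.
by rewrite -leqNgt => Pl; rewrite nth_default // scale0r (morph_add0 (pure3D1 _ _)).
Qed.

Lemma normal3_add a b c : {morph normal3 a b c : P Q / P + Q}.
Proof.
move=> P Q; pose k := maxn (size P) (size Q).
rewrite !(@normal3E k) ?leq_maxl ?leq_maxr ?size_polyD //.
by rewrite -big_split; apply: eq_bigr => l _ /=; rewrite coefD scalerDl pure3D1.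
Qed.

Lemma normal3_pure p q a b c :
  normal3 a b c (psubst2 lambda p * psubst2 mu q) = pure3 (p *: a) (q *: b) c.
Proof.
rewrite psubst2_polyC psubst2_mu mul_polyC (@normal3E (size q)); last first.
  by apply: leq_trans (size_scale_leq _ _) _; rewrite size_map_poly.
rewrite -[in RHS](coefK q) poly_def scaler_suml (morph_sum (pure3D2 _ _)).
apply: eq_bigr => l _; rewrite coefZ coef_map /= -mul_polyC -[in RHS]scalerA pure3Z2.
by rewrite scalerA mulrC.
Qed.

(** Modulo the total derivation, d on the third factor is minus the sum of the
    derivations on the first two, that is - lambda - mu. *)
Lemma pure3_normal p q s (a b c : A) :
  congr_im (@dd3 K A) (pure3 (p *: a) (q *: b) (s *: c))
    (normal3 a b c
       (psubst2 lambda p * psubst2 mu q * psubst2 (- (lambda + mu)) s)).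
Proof.
have D := @dd3_add K A.
elim/poly_ind: s p q => [|s k IH] p q.
  rewrite scale0r (morph_add0 (@psubst2D _ _)) mulr0 (morph_add0 (pure3D3 _ _)).
  by rewrite (morph_add0 (normal3_add _ _ _)); exact: congr_im_refl.
rewrite scalerDl pure3D3 psubst2D mulrDr normal3_add.
apply: congr_imD => //; last first.
  have -> : psubst2 lambda p * psubst2 mu q * psubst2 (- (lambda + mu)) k%:P =
      psubst2 lambda (k%:P * p) * psubst2 mu q.
    by rewrite psubst2M !psubst2C; ring.
  by rewrite pure3Z3 scalerA normal3_pure; exact: congr_im_refl.
apply: (@congr_im_trans _ _ D
  (- (pure3 (('X * p) *: a) (q *: b) (s *: c) + pure3 (p *: a) (('X * q) *: b) (s *: c)))).
  exists (pure3 (p *: a) (q *: b) (s *: c)).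
  by rewrite opprK dd3_pure !scalerA (mulrC s) addrC.
have -> : psubst2 lambda p * psubst2 mu q * psubst2 (- (lambda + mu)) (s * 'X) =
   - (psubst2 lambda ('X * p) * psubst2 mu q * psubst2 (- (lambda + mu)) s +
      psubst2 lambda p * psubst2 mu ('X * q) * psubst2 (- (lambda + mu)) s).
  by rewrite !psubst2M !psubst2X; ring.
rewrite (morph_addN (normal3_add _ _ _)) normal3_add.
by apply: congr_imN => //; apply: congr_imD.
Qed.

(** The normal form of t has the values of t at triples of dual basis elements
    as its coefficients. *)
Lemma dd3_separated (t : tensor3 A) :
  (forall f g h : cdual A,
    ev3 (fun a => psubst2 lambda (f a)) (fun b => psubst2 mu (g b))
        (fun c => psubst2 (- (lambda + mu)) (h c)) t = 0) ->
  exists s, t = dd3 s.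
Proof.
have D := @dd3_add K A.
pose ev i j k := ev3 (fun a => psubst2 lambda (d i a)) (fun b => psubst2 mu (d j b))
  (fun c => psubst2 (- (lambda + mu)) (d k c)).
have evD i j k : {morph ev i j k : s t / s + t}.
  by apply: ev3_add; exact: cdual_linear_at.
pose nf s := \sum_i \sum_j \sum_k normal3 (e i) (e j) (e k) (ev i j k s).
have nfD : {morph nf : s s' / s + s'}.
  move=> s s'; rewrite /nf -big_split; apply: eq_bigr => i _.
  rewrite -big_split; apply: eq_bigr => j _.
  rewrite -big_split; apply: eq_bigr => k _ /=.
  by rewrite evD normal3_add.
have nf0 : congr_im (@dd3 K A) 0 (nf 0).
  by rewrite (morph_add0 nfD); exact: congr_im_refl.
have nfP s : congr_im (@dd3 K A) s (nf s).
  elim/tens_induction: s => [|s s' es es'|u c] //.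
    by rewrite nfD; exact: congr_imD.
  elim/tens_induction: u => [|u u' eu eu'|a b]; first by rewrite tens_pure0.
    by rewrite tens_pureDl nfD; exact: congr_imD.
  rewrite -/(pure2 a b) -/(pure3 a b c) {1}[a]dec {1}[b]dec {1}[c : A]dec.
  rewrite (morph_sum (pure3D1 _ _)); apply: congr_im_sum => // i.
  rewrite (morph_sum (pure3D2 _ _)); apply: congr_im_sum => // j.
  rewrite (morph_sum (pure3D3 _ _)); apply: congr_im_sum => // k.
  rewrite /ev !(ev3_pure (cdual_linear_at _ _) (cdual_linear_at _ _) (cdual_linear_at _ _)).
  exact: pure3_normal.
move=> t0; have [s] := nfP t; rewrite [nf t]big1 ?subr0; first by exists s.
move=> i _; rewrite big1 // => j _; rewrite big1 // => k _.
by rewrite /ev t0 (morph_add0 (normal3_add _ _ _)).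
Qed.

End Separation.

(** * The S-equation and the cocycle identity *)

Section SEquation.
Variables (K : fieldType) (A : lmodType {poly K}).
Local Notation B := {poly {poly K}}.
Local Notation lambda := ('X%:P : B).
Local Notation mu := ('X : B).

Section Product.
Variable m : A -> A -> {malg A[nat]}.
Hypothesis m_lsc : left_symmetric_conformal m.

Definition lact (w : B) (phi : A -> B) (a b : A) : B :=
  mpsubst ( *%R w) phi (m a b).

Variables (z : B) (phi : A -> B).
Hypothesis phiL : linear_at z phi.
Let phiD := linear_atD phiL.

Lemma linear_at_cscale k a : phi (cscale k a) = k%:P%:P * phi a.
Proof. by rewrite /cscale (linear_atZ phiL) psubst2C. Qed.

Lemma linear_at_dd a : phi (dd a) = z * phi a.
Proof. by rewrite /dd (linear_atZ phiL) psubst2X. Qed.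

Lemma lact_linear_at_l w b : linear_at (- w) (fun a => lact w phi a b).
Proof.
apply: linear_at_generators => [a a'|k a|a]; rewrite /lact.
- by rewrite (lsc_Dl m_lsc) (mpsubst_mulD w phiD).
- by rewrite (lsc_Zl m_lsc) (mpsubst_mpmap w phiD _ (linear_at_cscale k)).
- rewrite (lsc_ddl m_lsc) (morph_addN (mpsubst_mulD w phiD)).
  by rewrite (mpsubst_lam w phiD) mulNr.
Qed.

Lemma lact_linear_at_r w a : linear_at (w + z) (lact w phi a).
Proof.
apply: linear_at_generators => [b b'|k b|b]; rewrite /lact.
- by rewrite (lsc_Dr m_lsc) (mpsubst_mulD w phiD).
- by rewrite (lsc_Zr m_lsc) (mpsubst_mpmap w phiD _ (linear_at_cscale k)).
- rewrite (lsc_ddr m_lsc) (mpsubst_mulD w phiD) (mpsubst_lam w phiD).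
  by rewrite (mpsubst_mpmap w phiD _ linear_at_dd) addrC mulrDl.
Qed.

(** phi turns d into z, hence - w - d into - w - z. *)
Lemma mpsubst_lbracket w a b :
  mpsubst ( *%R w) phi (lbracket m a b) = lact w phi a b - lact (- w - z) phi b a.
Proof.
have gD := mpsubst_mulD w phiD.
rewrite /lbracket gD (morph_addN gD); congr (_ - _).
rewrite (mpsubst_morph (D' := *%R (- w - z)) _ _ gD); last first.
  move=> p; rewrite /opp_lam_dd gD !(morph_addN gD) (mpsubst_lam w phiD).
  by rewrite (mpsubst_mpmap w phiD _ linear_at_dd) mulrBl mulNr.
rewrite /lact; congr mpsubst; apply/funext => v /=.
by rewrite /mpcst (mpsubst_mulU w phiD) mul1r.
Qed.

End Product.

Lemma mpsubst_factor (V : zmodType) (w k : B) (g g' : V -> B) p :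
  (forall v, g v = k * g' v) ->
  mpsubst ( *%R w) g p = k * mpsubst ( *%R w) g' p.
Proof.
move=> gg'; rewrite /mpsubst mulr_sumr; apply: eq_bigr => l _.
by rewrite !iter_mulr gg' mulrCA.
Qed.

Section Element.
Variables (n : nat) (x y : 'I_n -> A).
Local Notation T := (T0 x y).

(** The two sign changes cancel: scalars act on f through d |-> - lambda, and T
    evaluates f at lambda = - d. *)
Lemma T0_linear : linear T.
Proof.
move=> p f g; rewrite !T0E scaler_sumr -big_split; apply: eq_bigr => i _ /=.
rewrite rmorphD rmorphM /= scalerDl -comp_polyA -scalerA.
by rewrite raddfN /= comp_polyX opprK comp_polyXr.
Qed.

Lemma linear_at_T0 z phi f : linear_at z phi ->
  phi (T f) = \sum_i psubst2 (- z) (f (x i)) * phi (y i).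
Proof.
move=> phiL; rewrite T0E (morph_sum (linear_atD phiL)).
by apply: eq_bigr => i _; rewrite (linear_atZ phiL) psubst2N.
Qed.

(** phi (x) psi kills the image of the total derivation. *)
Lemma symmetric_mod_swap : symmetric_tensor_mod x y ->
  forall z phi psi, linear_at z phi -> linear_at (- z) psi ->
  \sum_i phi (x i) * psi (y i) = \sum_i phi (y i) * psi (x i).
Proof.
case=> t xy z phi psi phiL psiL; apply/eqP; rewrite -subr_eq0.
have evD := ev2_add phiL psiL.
have <- : ev2 phi psi (elt2 x y - elt2_flip x y) =
    \sum_i phi (x i) * psi (y i) - \sum_i phi (y i) * psi (x i).
  rewrite evD (morph_addN evD) /elt2 /elt2_flip !(morph_sum evD).
  by congr (_ - _); apply: eq_bigr => i _; rewrite (ev2_pure phiL psiL).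
by rewrite xy (ev2_dd2 phiL psiL) subrr mul0r.
Qed.

Definition symmetric_pairing : Prop :=
  forall f g : cdual A, f (T g) = g (T f) \Po - 'X.

Lemma symmetric_mod_pairing : symmetric_tensor_mod x y -> symmetric_pairing.
Proof.
move=> xy f g; apply: polyC_inj; rewrite -(psubst2_polyC (f _)) -(psubst2_polyC (_ \Po _)) psubst2N.
have fL := cdual_linear_at lambda f; have gL := cdual_linear_at (- lambda) g.
rewrite (linear_at_T0 g fL) (linear_at_T0 f gL) opprK.
rewrite (symmetric_mod_swap xy fL gL); apply: eq_bigr => i _.
exact: mulrC.
Qed.

(** The hypothesis says that the products f_lambda (x) g_(-lambda) do not
    distinguish r from its flip; on a finite free module they separate tensors
    modulo the total derivation. *)
Lemma pairing_symmetric_mod : finitely_generated A -> free_module A ->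
  symmetric_pairing -> symmetric_tensor_mod x y.
Proof.
move=> fgA frA sym; have [N [e [d dec]]] := finite_free_dual_basis fgA frA.
apply: (dd2_separated dec) => f g.
have fL := cdual_linear_at lambda f; have gL := cdual_linear_at (- lambda) g.
have evD := ev2_add fL gL.
rewrite evD (morph_addN evD) /elt2 /elt2_flip !(morph_sum evD).
under eq_bigr do rewrite (ev2_pure fL gL).
under [X in _ - X]eq_bigr do rewrite (ev2_pure fL gL) mulrC.
rewrite -{1}[lambda]opprK -(linear_at_T0 f gL) -(linear_at_T0 g fL).
by rewrite sym psubst2N opprK subrr.
Qed.

Variable m : A -> A -> {malg A[nat]}.
Hypothesis m_lsc : left_symmetric_conformal m.

(** Up to sign, the difference of the two sides of the cocycle identity at
    a = T f, b = T g, c = T h, with beta_(lambda + mu)(u, c) replaced by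
    h_(- lambda - mu)(u), to which it is equal when beta is symmetric. *)
Definition cocycle_defect (f g h : cdual A) (a b c : A) : B :=
  lact m mu (fun u => psubst2 lambda (f u)) b c
  - lact m lambda (fun u => psubst2 mu (g u)) a c
  - (lact m lambda (fun u => psubst2 (- (lambda + mu)) (h u)) a b
     - lact m mu (fun u => psubst2 (- (lambda + mu)) (h u)) b a).

Lemma lact_T0 w z phi (g h : cdual A) : linear_at z phi ->
  lact m w phi (T g) (T h) =
  \sum_i \sum_j psubst2 w (g (x i)) * psubst2 (- (w + z)) (h (x j))
                * lact m w phi (y i) (y j).
Proof.
move=> phiL; rewrite (linear_at_T0 g (lact_linear_at_l m_lsc phiL w _)) opprK.
apply: eq_bigr => i _.
rewrite (linear_at_T0 h (lact_linear_at_r m_lsc phiL w _)) mulr_sumr.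
by apply: eq_bigr => j _; rewrite mulrA.
Qed.

(** Same expansion as [lact_T0], but with r replaced by its flip in the second
    argument: this is the order of the factors in the S-equation. *)
Lemma lact_T0_swap w z phi (g h : cdual A) : linear_at z phi ->
  symmetric_tensor_mod x y ->
  lact m w phi (T g) (T h) =
  \sum_i \sum_j psubst2 w (g (x j)) * psubst2 (- (w + z)) (h (y i))
                * lact m w phi (y j) (x i).
Proof.
move=> phiL xy; rewrite (lact_T0 w g h phiL) [RHS]exchange_big.
apply: eq_bigr => j _ /=.
have rL := lact_linear_at_r m_lsc phiL w (y j).
have hL := cdual_linear_at (- (w + z)) h.
have swap := symmetric_mod_swap xy rL hL.
under eq_bigr do rewrite -mulrA.
under [RHS]eq_bigr do rewrite -mulrA.
rewrite -!mulr_sumr; congr (_ * _).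
under eq_bigr do rewrite mulrC.
by rewrite -swap; apply: eq_bigr => i _; exact: mulrC.
Qed.

(** The three sums of the S-equation become f_lambda(b_mu c), g_mu(a_lambda c)
    and h_(- lambda - mu)([a_lambda b]), where a = T f, b = T g and c = T h. The
    first two sums involve r_i (x) l_i in the order opposite to that of T h,
    whence the use of symmetry. *)
Lemma ev3_S (f g h : cdual A) : symmetric_tensor_mod x y ->
  ev3 (fun a => psubst2 lambda (f a)) (fun b => psubst2 mu (g b))
      (fun c => psubst2 (- (lambda + mu)) (h c)) (S_lhs m x y) =
  cocycle_defect f g h (T f) (T g) (T h).
Proof.
move=> xy; set phi := fun a => psubst2 lambda (f a).
set psi := fun b => psubst2 mu (g b); set chi := fun c => _.
have fL : linear_at lambda phi := cdual_linear_at lambda f.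
have gL : linear_at mu psi := cdual_linear_at mu g.
have hL : linear_at (- (lambda + mu)) chi := cdual_linear_at _ h.
have evD := ev3_add fL gL hL; have evN := morph_addN evD.
have evP := ev3_pure fL gL hL.
rewrite /S_lhs !evD !evN !(morph_sum evD) /cocycle_defect.
congr (_ - _ - _).
- rewrite (lact_T0_swap _ g h fL xy); apply: eq_bigr => i _.
  rewrite (morph_sum evD); apply: eq_bigr => j _.
  rewrite (mpsubst_morph _ _ evD (ev3_dd3_2 fL gL hL)).
  rewrite (@mpsubst_factor _ _ (psi (x j) * chi (y i)) _ phi); last first.
    by move=> v /=; rewrite evP; ring.
  by rewrite -/(lact m _ _ _ _) [mu + _]addrC -/(chi _) -/(psi _); ring.
- rewrite (lact_T0_swap _ f h gL xy); apply: eq_bigr => i _.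
  rewrite (morph_sum evD); apply: eq_bigr => j _.
  rewrite (mpsubst_morph _ _ evD (ev3_dd3_1 fL gL hL)).
  rewrite (@mpsubst_factor _ _ (phi (x j) * chi (y i)) _ psi); last first.
    by move=> v /=; rewrite evP; ring.
  by rewrite -/(lact m _ _ _ _) -/(chi _) -/(phi _); ring.
rewrite (lact_T0 lambda f g hL) (lact_T0 mu g f hL) [X in _ = _ - X]exchange_big.
rewrite -sumrB; apply: eq_bigr => i _; rewrite -sumrB (morph_sum evD).
apply: eq_bigr => j _.
rewrite (mpsubst_morph _ _ evD (ev3_dd3_1 fL gL hL)).
rewrite (@mpsubst_factor _ _ (phi (x i) * psi (x j)) _ chi); last first.
  by move=> v /=; rewrite evP.
rewrite (mpsubst_lbracket m hL).
have -> : - lambda - - (lambda + mu) = mu by ring.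
have -> : - (lambda + - (lambda + mu)) = mu by ring.
have -> : - (mu + - (lambda + mu)) = lambda by ring.
by rewrite -/(phi _) -/(psi _); ring.
Qed.

Lemma conformal_S_equation_defect : finitely_generated A -> free_module A ->
  symmetric_tensor_mod x y ->
  conformal_S_equation m x y <->
  forall f g h, cocycle_defect f g h (T f) (T g) (T h) = 0.
Proof.
move=> fgA frA xy; split=> [[t St] f g h|defect0].
  rewrite -ev3_S // St (ev3_dd3 (cdual_linear_at _ f) (cdual_linear_at _ g)
    (cdual_linear_at _ h)).
  by rewrite subrr mul0r.
have [N [e [d dec]]] := finite_free_dual_basis fgA frA.
by apply: (dd3_separated dec) => f g h; rewrite ev3_S.
Qed.

(** Symmetry moves c to the left of beta_(lambda + mu)(u, c), at the price of
    evaluating at - lambda - mu; the rest is a rearrangement of terms. *)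
Lemma cocycle_eq_defect (Tinv : A -> cdual A) (beta := fun a b => Tinv a b) :
  symmetric_conformal_form beta -> forall a b c,
  (cocycle_l m beta lambda (lambda + mu) a b c - cocycle_r m beta lambda mu a b c =
   cocycle_l m beta mu (lambda + mu) b a c - cocycle_r m beta mu lambda b a c)
  <-> cocycle_defect (Tinv a) (Tinv b) (Tinv c) a b c = 0.
Proof.
move=> sym a b c.
have lE w a' b' : cocycle_l m beta w (lambda + mu) a' b' c =
    lact m w (fun u => psubst2 (- (lambda + mu)) (Tinv c u)) a' b'.
  rewrite /cocycle_l /lact; congr mpsubst; apply/funext => u.
  by rewrite sym psubst2N.
rewrite !lE /cocycle_defect -[cocycle_r m beta lambda mu a b c]/(lact m mu _ b c).
rewrite -[cocycle_r m beta mu lambda b a c]/(lact m lambda _ a c).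
split=> [/eqP|/eqP]; rewrite -subr_eq0 => /eqP e; last first.
  apply/eqP; rewrite -subr_eq0 -oppr_eq0; apply/eqP; rewrite -[RHS]e; ring.
by apply: oppr_inj; rewrite oppr0 -e; ring.
Qed.

(** The induced form inherits sesquilinearity from the linearity of the inverse
    of T and from the dual; what remains are the two conditions compared
    above. *)
Theorem S_equation_iff_cocycle : finitely_generated A -> free_module A ->
  (symmetric_tensor_mod x y /\ nondegenerate_tensor x y /\
     conformal_S_equation m x y) <->
  induced_symmetric_cocycle m x y.
Proof.
move=> fgA frA; split=> [[xy [[_ [Tinv TK KT]] S]]|[Tinv [TK KT coc sym]]].
  have sym : symmetric_conformal_form (fun a b => Tinv a b).
    move=> a b; rewrite -{1}(KT b) -[in RHS](KT a).
    exact: symmetric_mod_pairing.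
  have Tinv_lin : linear Tinv.
    by move=> p a b; apply: (can_inj TK); rewrite T0_linear !KT.
  have TinvZ p a b : Tinv (p *: a) b = (p \Po - 'X) * Tinv a b.
    have := Tinv_lin p a 0; rewrite addr0 => ->.
    have /= -> : Tinv 0 = 0.
      by have := Tinv_lin (-1) 0 0; rewrite !scaleN1r oppr0 addr0 addNr.
    by rewrite addr0.
  exists Tinv; split=> //; split.
  - move=> c a b /=; have := Tinv_lin 1 a b; rewrite !scale1r => ->.
    by [].
  - by move=> a b c; exact: cdualD.
  - by move=> c a b; rewrite /cscale TinvZ comp_polyC mul_polyC.
  - by move=> c a b; exact: cdualZ.
  - by move=> a b; rewrite /dd TinvZ comp_polyX.
  - by move=> a b; exact: cdual_dd.
  move=> a b c /=; apply/(cocycle_eq_defect sym).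
  have := (conformal_S_equation_defect fgA frA xy).1 S (Tinv a) (Tinv b) (Tinv c).
  by rewrite !KT.
have xy : symmetric_tensor_mod x y.
  apply: pairing_symmetric_mod => // f g.
  by have := sym (T f) (T g); rewrite !TK.
split=> //; split; first by split; [exact: T0_linear | exists Tinv].
apply/(conformal_S_equation_defect fgA frA xy) => f g h.
have := (cocycle_eq_defect sym (T f) (T g) (T h)).1 (cocycle_eq coc _ _ _).
by rewrite !TK.
Qed.

End Element.
End SEquation.

Theorem theorem5p7 (R : realType) (A : lmodType {poly R[i]})
    (m : A -> A -> {malg A[nat]})
    (A_lsc : left_symmetric_conformal m)
    (A_finite : finitely_generated A)
    (A_free : free_module A)
    (n : nat) (x y : 'I_n -> A) :
  ((symmetric_tensor x y /\ nondegenerate_tensor x y /\ conformal_S_equation m x y) <->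
   (symmetric_tensor x y /\ induced_symmetric_cocycle m x y))
  /\
  ((symmetric_tensor_mod x y /\ nondegenerate_tensor x y /\ conformal_S_equation m x y) <->
   induced_symmetric_cocycle m x y).
Proof.
have main := S_equation_iff_cocycle x y A_lsc A_finite A_free.
have sym_mod : symmetric_tensor x y -> symmetric_tensor_mod x y.
  by move=> e; exists 0; rewrite e subrr (morph_add0 (@dd2_add _ A)).
split=> //; split=> [[xy [T_iso S]]|[xy coc]]; split=> //.
  by apply/main; split; first exact: sym_mod.
by have [] := main.2 coc.
Qed.
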